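(* Let $K$ be a commutative ring with $1$, let $R_n=K[x_1,\ldots,x_n]$ and $R_i=K[x_{n-i+1},\ldots,x_n]$ for $0\le i\le n$ (so $R_0=K$). Let $\Delta\subset\mathbb{N}^n$ be a (nonempty) diagram of finite type with associated sets $\Gamma=\mathbb{N}^n\setminus\Delta$, $A_i$ and $\overline{B}_i$ ($i=1,\ldots,n$). Put $M^A_0=0$, $M^B_{n+1}=0$ and, for $i=1,\ldots,n$, $$M^A_i=\bigoplus_{\alpha\in A_i}R_{n-i}\cdot x^\alpha,\qquad M^B_i=\sum_{\beta\in\overline{B}_i}R_{n-i+1}\cdot x^\beta .$$ Then there is a decomposition $$R_n=\bigoplus_{i=1}^{n+1}(M^A_{i-1}\oplus M^B_i)=R_n^\Delta\oplus R_n^\Gamma$$ into a direct sum of free $R_{n-i+1}$-modules $M^A_{i-1}\oplus M^B_i$, where $$R_n^\Delta=\{f\in R_n\mid\operatorname{supp}(f)\subset\Delta\}=\bigoplus_{i=1}^{n+1}M^B_i,\qquad R_n^\Gamma=\{f\in R_n\mid\operatorname{supp}(f)\subset\Gamma\}=\bigoplus_{i=1}^{n+1}M^A_{i-1}.$$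
   Context: $\mathbb{N}$ includes $0$; $\operatorname{supp}(f)$ is the set of exponents of monomials occurring in $f$. A diagram is a set $\Delta=\bigcup_i(a_i+\mathbb{N}^n)$ for finitely many $a_i\in\mathbb{N}^n$; its vertices are its minimal generators. $\Delta$ is of finite type if for all $i<j$ and every $\alpha\in\Delta$ there is $\alpha_i'\in\mathbb{N}$ such that the vector obtained from $\alpha$ by replacing the $i$-th coordinate by $\alpha_i+\alpha_i'$ and the $j$-th coordinate by $0$ lies in $\Delta$. Identify $\mathbb{N}^i$ with $\mathbb{N}^i\times\{0\}\subset\mathbb{N}^n$, and let $\pi_{n,i}:\mathbb{N}^n\to\mathbb{N}^i$ be the projection onto the first $i$ coordinates. Put $\overline{\Gamma}^i=\mathbb{N}^i\setminus\pi_{n,i}(\Delta)$ and $A_i=\overline{\Gamma}^i\setminus(\overline{\Gamma}^{i-1}\times\mathbb{N})\subset\mathbb{N}^i$; then $\Gamma=\bigsqcup_{i}A_i\times\mathbb{N}^{n-i}$, and the $A_i$ are finite. Order the vertices by the reverse lexicographic order ($\alpha<_r\beta$ iff $(\alpha_n,\ldots,\alpha_1)<_{\rm lex}(\beta_n,\ldots,\beta_1)$) and label by $\alpha_{i,j}$, $j=1,2,\ldots$, those vertices for which $i\ge1$ is the smallest index with $\alpha_{i,j}\in\mathbb{N}^i$. Put $\Delta_{i,j}=(\alpha_{i,j}+\mathbb{N}^n)\setminus\bigcup_{\alpha<_r\alpha_{i,j}}(\alpha+\mathbb{N}^n)$ (union over vertices $\alpha$) and $\Gamma_{i,j}=\Delta_{i,j}-\alpha_{i,j}$.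 Then $\Gamma_{i,j}=\overline{\Gamma}_{i,j}\times\mathbb{N}^{n-i+1}$ for a finite set $\overline{\Gamma}_{i,j}\subset\mathbb{N}^{i-1}$. Put $\overline{B}_{i,j}=\alpha_{i,j}+\overline{\Gamma}_{i,j}$ (with $\overline{\Gamma}_{i,j}\subset\mathbb{N}^{i-1}\subset\mathbb{N}^n$) and $\overline{B}_i=\bigcup_j\overline{B}_{i,j}$. *)

(* Defs.v *)
From HB Require Import structures.
From mathcomp Require Import all_boot all_order all_algebra.
From mathcomp Require Import mpoly.
From mathcomp Require Import boolp classical_sets.

Set Implicit Arguments.
Unset Strict Implicit.
Unset Printing Implicit Defensive.

Import Order.TTheory GRing.Theory.

Local Open Scope classical_set_scope.
Local Open Scope ring_scope.

(** N^n is ['X_{1..n}]. Coordinates are numbered from 0, so the i-th coordinate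
    of the mathematical text is the coordinate of index i - 1. *)

Section Diagrams.
Variable n : nat.
Implicit Types (D : set 'X_{1..n}) (a b g : 'X_{1..n}) (i k : nat).

Definition cone a : set 'X_{1..n} := [set (a + g)%MM | g in [set: 'X_{1..n}]].

Definition diagram D : Prop :=
  exists s : seq 'X_{1..n}, D = \bigcup_(a in [set` s]) cone a.

(** The minimal generating set of a diagram consists of the elements that lie
    in no cone over another element. *)
Definition vertex D a : Prop :=
  D a /\ forall b, D b -> cone b a -> b = a.

Definition finite_type D : Prop :=
  forall (i j : 'I_n), (i < j)%N -> forall a, D a ->
    exists c : nat,
      D [multinom if k == i then (a i + c)%N else if k == j then 0%N else a k
        | k < n].

(** N^i, identified with N^i x {0}. *)
Definition Nsub i : set 'X_{1..n} :=
  [set a | forall j : 'I_n, (i <= j)%N -> a j = 0%N].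

(** The projection pi_{n,i}, followed by the embedding of N^i into N^n. *)
Definition proj i a : 'X_{1..n} := [multinom if (j < i)%N then a j else 0%N | j < n].

(** X x N as a subset of N^i, for X contained in N^(i-1). *)
Definition timesN i (X : set 'X_{1..n}) : set 'X_{1..n} :=
  [set a | Nsub i a /\ X (proj i.-1 a)].

Definition Gbar D i : set 'X_{1..n} := Nsub i `\` (proj i @` D).

Definition Aset D i : set 'X_{1..n} := Gbar D i `\` timesN i (Gbar D i.-1).

(** alpha <_r beta: the sequences listed from the last coordinate to the first
    are compared lexicographically. *)
Definition revlex a b : bool :=
  (([seq a j | j <- rev (enum 'I_n)] : seqlexi nat)
     < [seq b j | j <- rev (enum 'I_n)])%O.

Definition level a i : Prop :=
  [/\ (0 < i)%N, Nsub i a & forall k, (0 < k)%N -> Nsub k a -> (i <= k)%N].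

(** The vertices of level i are not numbered: they are the alpha_{i,j}, and the
    sets with index (i,j) are written as functions of alpha_{i,j} instead. *)
Definition cell D a : set 'X_{1..n} :=
  cone a `\` \bigcup_(b in [set b | vertex D b /\ revlex b a]) cone b.

Definition cell_shift D a : set 'X_{1..n} := [set g | cell D a (a + g)%MM].

(** [cell_shift D a] is a product of a subset of N^(i-1) with N^(n-i+1) when a is
    a vertex of level i; the first factor is therefore its projection. *)
Definition Gbar_shift D i a : set 'X_{1..n} := proj i.-1 @` cell_shift D a.

Definition Bset D i : set 'X_{1..n} :=
  \bigcup_(a in [set a | vertex D a /\ level a i])
    [set (a + g)%MM | g in Gbar_shift D i a].

End Diagrams.

(** Internal sums inside a fixed additive group. The summands below are modules
    over different rings, so only their additive structure is common. *)
Section Sums.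
Variables (V : zmodType) (I : choiceType).
Implicit Types (P : set I) (M : I -> set V) (N : set V).

Definition msum P M : set V :=
  [set f | exists (s : seq I) (v : I -> V),
     [/\ uniq s, forall i, i \in s -> P i /\ M i (v i) & f = \sum_(i <- s) v i]].

Definition msum_direct P M : Prop :=
  forall (s : seq I) (v : I -> V), uniq s ->
    (forall i, i \in s -> P i /\ M i (v i)) ->
    \sum_(i <- s) v i = 0 -> forall i, i \in s -> v i = 0.

Definition is_direct_sum N P M : Prop := N = msum P M /\ msum_direct P M.

End Sums.

Definition msum2 (V : zmodType) (M1 M2 : set V) : set V :=
  [set f + g | f in M1 & g in M2].

Definition is_direct_sum2 (V : zmodType) (N M1 M2 : set V) : Prop :=
  N = msum2 M1 M2 /\
  forall f g, M1 f -> M2 g -> f + g = 0 -> f = 0 /\ g = 0.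

Section Modules.
Variables (n : nat) (K : comNzRingType).
Local Notation Rn := {mpoly K[n]}.
Implicit Types (S M : set Rn) (e : Rn) (D : set 'X_{1..n}) (i : nat).

Definition cyclic_mod S e : set Rn := [set c * e | c in S].

(** M is a free module over the subring S: it has a basis E. *)
Definition free_mod S M : Prop :=
  exists E : set Rn, M = msum E (cyclic_mod S) /\
    forall (s : seq Rn) (c : Rn -> Rn), uniq s ->
      (forall e, e \in s -> E e /\ S (c e)) ->
      \sum_(e <- s) c e * e = 0 -> forall e, e \in s -> c e = 0.

(** The polynomials with all exponents in D. *)
Definition supported D : set Rn := [set f | forall m, m \in msupp f -> D m].

(** R_i = K[x_{n-i+1}, ..., x_n], the polynomials in the last i variables. *)
Definition Rlast i : set Rn :=
  supported [set m | forall j : 'I_n, (j < n - i)%N -> m j = 0%N].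

Definition MA D i : set Rn :=
  if (0 < i <= n)%N
  then msum (Aset D i) (fun a => cyclic_mod (Rlast (n - i)) 'X_[a])
  else [set 0].

(** R_{n-i+1} is [Rlast (n.+1 - i)]: with truncated subtraction, [n - i + 1]
    would be wrong for i = n + 1. *)
Definition MB D i : set Rn :=
  if (0 < i <= n)%N
  then msum (Bset D i) (fun b => cyclic_mod (Rlast (n.+1 - i)) 'X_[b])
  else [set 0].

End Modules.

Arguments Rlast {n} K i _.
Arguments supported {n} K D _.
Arguments MA {n} K D i _.
Arguments MB {n} K D i _.

(* Main.v *)
Require Import Defs.
From HB Require Import structures.
From mathcomp Require Import all_boot all_order all_algebra.
From mathcomp Require Import mpoly.
From mathcomp Require Import boolp classical_sets.

Set Implicit Arguments.
Unset Strict Implicit.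
Unset Printing Implicit Defensive.

Import Order.TTheory GRing.Theory.

Local Open Scope classical_set_scope.
Local Open Scope ring_scope.

(** Every module of the statement consists of all polynomials whose exponents lie
    in some set: [R_i] does by definition, and so does [R_{n-i} x^a], whose
    exponents are the translate by [a] of the exponents of [R_{n-i}]
    ([supported_translate]). For such modules, direct sum decompositions and bases
    are partitions of sets of exponents: a disjoint union of sets gives a direct
    sum ([direct_sum_supported]), because a polynomial can be cut into its pieces
    coefficient by coefficient, and a disjoint union of translates [a + T] makes
    the monomials [x^a] a basis over the polynomials with exponents in [T]
    ([free_translates]). It remains to partition N^n.

    Write [tail i] for the exponents whose first [i] coordinates vanish, i.e. for
    {0} x N^(n-i).

    The complement of [D]: for fixed [m], consider whether the first [i]
    coordinates of [m] are those of some element of [D]. As [i] grows from 0 to [n]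
    this passes at most once from true to false; it is true at 0 since [D] is not
    empty, and at [n] it says that [m] is in [D]. The exponents for which the passage
    occurs at [i] are exactly the translates of [tail i] by [A_i]
    ([Aset_translate]). So these blocks partition the complement of [D].

    The diagram [D]: every [m] in [D] lies in the cell of a unique vertex, the
    smallest vertex in the reverse lexicographic order that divides [x^m]. The key
    point ([cell_proj]) is that the cell of a vertex [a] of level [i] is stable under
    changes of the coordinates from the i-th on, as long as they stay above those
    of [a]: a vertex [b] before [a] also lies in N^i and its i-th coordinate is at
    most that of [a], so these coordinates never decide whether [b] divides a
    multiple of [x^a]. Hence the translates of [tail (i-1)] by the elements of [B_i]
    are disjoint and fill the cells of the vertices of level [i]
    ([trivIset_Bset], [Bset_translate]), and the level splits [D] into blocks.

    The translates belonging to [A_{i-1}] and to [B_i] both use [tail (i-1)], and the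
    former avoid [D] while the latter lie in it, so together they give the basis of
    the i-th summand over R_{n-i+1}. *)

(** * Polynomials with prescribed exponents *)

Definition translate n (T : set 'X_{1..n}) (a : 'X_{1..n}) : set 'X_{1..n} :=
  [set (a + g)%MM | g in T].

Section Supports.
Variables (n : nat) (K : comNzRingType).
Local Notation Rn := {mpoly K[n]}.
Implicit Types (X Y T E : set 'X_{1..n}) (a m : 'X_{1..n}) (f : Rn).

Lemma supportedP X f : supported K X f <-> forall m, ~ X m -> f@_m = 0.
Proof.
split=> [Xf m nXm|Xf m]; last first.
  by rewrite mcoeff_msupp => /eqP fm; apply: contrapT => /Xf.
by apply/eqP; rewrite mcoeff_eq0; apply/negP => /Xf.
Qed.

Lemma supported_sum (I : eqType) (s : seq I) (v : I -> Rn) X :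
  (forall i, i \in s -> supported K X (v i)) ->
  supported K X (\sum_(i <- s) v i).
Proof.
move=> Xv; apply/supportedP => m nXm; rewrite raddf_sum big1_seq // => i /andP[_ si].
by move/supportedP: (Xv i si); apply.
Qed.

Lemma supported_sub X Y f : X `<=` Y -> supported K X f -> supported K Y f.
Proof. by move=> XY Xf m /Xf /XY. Qed.

Lemma supported0 : supported K (@set0 'X_{1..n}) = [set 0].
Proof.
apply/seteqP; split=> [f /supportedP f0|_ ->]; last by move=> m; rewrite msupp0.
by apply/mpolyP => m; rewrite f0 ?mcoeff0.
Qed.

Lemma mpolyX_inj : injective (fun a => 'X_[a] : Rn).
Proof. by move=> a b /(congr1 (@msupp _ _)); rewrite !msuppX => -[]. Qed.

Definition restrict X f : Rn := \sum_(m <- msupp f | `[< X m >]) f@_m *: 'X_[m].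

Lemma mcoeff_restrict X f m :
  (restrict X f)@_m = if `[< X m >] then f@_m else 0.
Proof.
rewrite /restrict raddf_sum big_mkcond /=.
have [fm|fm] := boolP (m \in msupp f); last first.
  rewrite (_ : f@_m = 0) ?if_same; last by apply/eqP; rewrite mcoeff_eq0.
  rewrite big1_seq // => k /andP[_ fk]; case: ifP => // _.
  rewrite mcoeffZ mcoeffX; case: eqP => [km|]; last by rewrite mulr0.
  by rewrite -km fk in fm.
rewrite (bigD1_seq m) ?msupp_uniq //= big1_seq ?addr0.
  by rewrite mcoeffZ mcoeffX eqxx mulr1.
move=> k /andP[/negPf km _]; case: ifP => // _.
by rewrite mcoeffZ mcoeffX km mulr0.
Qed.

Lemma supported_restrict X f : supported K X (restrict X f).
Proof. by apply/supportedP => m nXm; rewrite mcoeff_restrict; case: asboolP. Qed.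

(** Existence: the piece in the i-th module keeps the coefficients at the exponents
    in [C i]. Directness: an exponent in [C i] receives no contribution from the
    other modules, so each coefficient of a piece is one of the whole sum. *)
Lemma direct_sum_supported (I : choiceType) (P : set I)
    (C : I -> set 'X_{1..n}) : trivIset P C ->
  is_direct_sum (supported K (\bigcup_(i in P) C i)) P (fun i => supported K (C i)).
Proof.
move=> tC; split.
  apply/seteqP; split=> [f Cf|f [s [v [_ Cv ->]]]]; last first.
    apply: supported_sum => i /Cv[Pi]; apply: supported_sub => m Cm; by exists i.
  have [->|] := eqVneq f 0.
    by exists [::], (fun=> 0); split=> //; rewrite big_nil.
  rewrite -msupp_eq0; case E: (msupp f) => [//|m0 s0] _.
  have [i0 _ _] : (\bigcup_(i in P) C i) m0 by apply: Cf; rewrite E mem_head.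
  (* The finitely many indices that matter are those of the sets met by the
     exponents of f; i0 is only a default value. *)
  pose idx m := xget i0 [set i | P i /\ C i m].
  have idxP m : m \in msupp f -> P (idx m) /\ C (idx m) m.
    by move=> /Cf[i Pi Cm]; apply: (@xgetPex _ i0 [set i | P i /\ C i m]); exists i.
  pose s := undup (map idx (msupp f)).
  have sP i : i \in s -> P i.
    by rewrite mem_undup => /mapP[m /idxP[Pm _] ->].
  exists s, (fun i => restrict (C i) f); split; first exact: undup_uniq.
    by move=> i /sP Pi; split=> //; apply: supported_restrict.
  apply/mpolyP => m; rewrite raddf_sum /=.
  under eq_bigr do rewrite mcoeff_restrict.
  have [fm|fm] := boolP (m \in msupp f); last first.
    rewrite (_ : f@_m = 0); last by apply/eqP; rewrite mcoeff_eq0.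
    by rewrite big1 // => i _; rewrite if_same.
  have [Pm Cm] := idxP m fm.
  rewrite (bigD1_seq (idx m)) ?undup_uniq //= ?mem_undup ?map_f //.
  rewrite asboolT // big1_seq ?addr0 // => j /andP[/eqP jm /sP Pj].
  case: asboolP => // Cj; case: jm; apply: tC => //; by exists m.
move=> s v us Cv v0 i si; apply/mpolyP => m; rewrite mcoeff0.
have [Pi /supportedP Ci] := Cv i si.
have [Cm|/Ci//] := pselect (C i m).
have := congr1 (mcoeff m) v0; rewrite mcoeff0 raddf_sum (bigD1_seq i) //=.
rewrite big1_seq ?addr0 // => j /andP[/eqP ji sj].
have [Pj /supportedP Cj] := Cv j sj.
by apply: Cj => Cj; case: ji; apply: tC => //; exists m.
Qed.

Lemma direct_sum2_supported X Y : X `&` Y = set0 ->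
  is_direct_sum2 (supported K (X `|` Y)) (supported K X) (supported K Y).
Proof.
move=> XY0; have nXY m : X m -> Y m -> False.
  by move=> Xm Ym; have : (X `&` Y) m by []; rewrite XY0.
split.
  apply/seteqP; split=> [f /supportedP XYf|_ [f /supportedP Xf [g /supportedP Yg <-]]]; last first.
    by apply/supportedP => m /not_orP[nX nY]; rewrite mcoeffD Xf ?Yg ?addr0.
  exists (restrict X f); first exact: supported_restrict.
  exists (restrict Y f); first exact: supported_restrict.
  apply/mpolyP => m; rewrite mcoeffD !mcoeff_restrict.
  case: asboolP => Xm; case: asboolP => Ym; rewrite ?addr0 ?add0r //.
    by case: (nXY m).
  by rewrite XYf // => -[].
move=> f g /supportedP Xf /supportedP Yg fg0.
have fg m : f@_m + g@_m = 0 by rewrite -mcoeffD fg0 mcoeff0.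
split; apply/mpolyP => m; rewrite mcoeff0; have [Xm|nXm] := pselect (X m).
- by rewrite -(fg m) Yg ?addr0 // => /(nXY m).
- exact: Xf.
- by apply: Yg => /(nXY m).
- by rewrite -(fg m) Xf ?add0r.
Qed.

(** This is how the cyclic modules of the statement become sets of exponents. *)
Lemma supported_translate T a :
  supported K (translate T a) = cyclic_mod (supported K T) 'X_[a].
Proof.
apply/seteqP; split=> [f Tf|_ [c /supportedP Tc <-]]; last first.
  move=> m; rewrite (perm_mem (msuppMX _ _)) => /mapP[k ck ->].
  exists k => //; apply: contrapT => /Tc ck0.
  by rewrite mcoeff_msupp ck0 eqxx in ck.
exists (\sum_(m <- msupp f) f@_m *: 'X_[(m - a)%MM]).
  apply: supported_sum => m /Tf[g Tg <-] k.
  by rewrite addmC addmK => /msuppZ_le; rewrite msuppX inE => /eqP->.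
rewrite mulr_suml [RHS]mpolyE; apply: eq_big_seq => m /Tf[g Tg <-].
by rewrite -scalerAl -mpolyXD submK // lem_addr.
Qed.

Lemma direct_sum_translates E T : trivIset E (translate T) ->
  is_direct_sum (supported K (\bigcup_(a in E) translate T a)) E
    (fun a => cyclic_mod (supported K T) 'X_[a]).
Proof.
move=> /direct_sum_supported; congr is_direct_sum.
by apply/funext => a; rewrite supported_translate.
Qed.

(** The basis is the set of monomials [x^a]. Freeness is directness of the sum of
    the cyclic modules, together with the fact that [x^a] is not a zero divisor. *)
Lemma free_translates E T : trivIset E (translate T) ->
  free_mod (supported K T) (supported K (\bigcup_(a in E) translate T a)).
Proof.
(* A basis is indexed by its own elements, so the translates are reindexed by the
   monomials. *)
move=> tE; pose C (e : Rn) := \bigcup_(a in [set a | e = 'X_[a]]) translate T a.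
have CX a : C 'X_[a] = translate T a.
  apply/seteqP; split=> m; last by exists a.
  by case=> b /mpolyX_inj ->.
pose B := [set ('X_[a] : Rn) | a in E].
have tB : trivIset B C.
  move=> _ _ [a Ea <-] [b Eb <-]; rewrite !CX => ab.
  by congr 'X_[_]; apply: tE.
have := direct_sum_supported tB.
rewrite (_ : \bigcup_(e in B) C e = \bigcup_(a in E) translate T a); last first.
  by rewrite bigcup_image; apply: eq_bigcupr => a _; rewrite CX.
have EC e : B e -> supported K (C e) = cyclic_mod (supported K T) e.
  by case=> a _ <-; rewrite CX supported_translate.
case=> EB dB; exists B; split.
  rewrite EB; apply/seteqP.
  split=> _ [s [v [us sv ->]]]; exists s, v; split=> // e /sv[Be].
    by rewrite EC.
  by rewrite -EC.
move=> s c us sc c0 e es.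
have [[a Ea ae] Tc] := sc e es.
have : c e * e = 0.
  apply: (dB s (fun e => c e * e)) => // e' /sc[Be Tce]; split=> //.
  by rewrite EC //; exists (c e').
rewrite -ae => cX0; apply/mpolyP => m.
by rewrite -(mcoeffMX _ a) cX0 !mcoeff0.
Qed.

End Supports.

(** * Truncation of exponents, and cones *)

Section Exponents.
Variable n : nat.
Implicit Types (D : set 'X_{1..n}) (a b g m : 'X_{1..n}) (i k : nat).

Definition tail i : set 'X_{1..n} :=
  [set m | forall j : 'I_n, (j < i)%N -> m j = 0%N].

Lemma projE i m (j : 'I_n) : proj i m j = if (j < i)%N then m j else 0%N.
Proof. by rewrite mnmE. Qed.

Lemma Nsub_proj i m : Nsub i (proj i m).
Proof. by move=> j ij; rewrite projE ltnNge ij. Qed.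

Lemma proj_Nsub i a : Nsub i a -> proj i a = a.
Proof. by move=> ai; apply/mnmP => j; rewrite projE; case: ltnP => // /ai. Qed.

Lemma proj_proj i k m : proj i (proj k m) = proj (minn i k) m.
Proof. by apply/mnmP => j; rewrite !projE leq_min; do 2!case: ltnP. Qed.

Lemma proj_addm i a b : proj i (a + b)%MM = (proj i a + proj i b)%MM.
Proof. by apply/mnmP => j; rewrite mnmDE !projE mnmDE; case: ltnP. Qed.

Lemma proj_tail i g : tail i g -> proj i g = 0%MM.
Proof. by move=> gi; apply/mnmP => j; rewrite projE mnm0E; case: ltnP => // /gi. Qed.

Lemma proj_translate i a m : Nsub i a ->
  translate (tail i) a m -> proj i m = a.
Proof.
by move=> ai [g gi <-]; rewrite proj_addm (proj_tail gi) addm0 proj_Nsub.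
Qed.

(** Together with [proj_translate]: the translates of [tail i] by elements of N^i
    partition N^n, and [proj i] finds the translate that contains [m]. *)
Lemma translate_proj i m : translate (tail i) (proj i m) m.
Proof.
exists (m - proj i m)%MM; first by move=> j ji; rewrite mnmBE projE ji subnn.
by apply/mnmP => j; rewrite mnmDE mnmBE projE; case: ltnP => // _; rewrite subnKC.
Qed.

Lemma coneP a m : cone a m <-> (a <= m)%MM.
Proof.
split=> [[g _ <-]|am]; first exact: lem_addr.
by exists (m - a)%MM => //; rewrite addmC submK.
Qed.

Lemma diagram_upward D a b : diagram D -> D a -> cone a b -> D b.
Proof.
move=> [s ->] [c sc /coneP ca] /coneP ab; exists c => //.
by apply/coneP; apply: lepm_trans ab.
Qed.

(** An element of [D] of least degree among those below [m] is a vertex. *)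
Lemma vertex_below D m : D m -> exists2 a, vertex D a & cone a m.
Proof.
move=> Dm; pose P k := `[< exists a, [/\ D a, cone a m & mdeg a = k] >].
have exP : exists k, P k.
  by exists (mdeg m); apply/asboolP; exists m; split=> //; apply/coneP/lepm_refl.
case: (ex_minnP exP) => k /asboolP[a [Da am <-]] min_a.
exists a => //; split=> // b Db /coneP ba.
have := min_a (mdeg b); rewrite /P; case: asboolP => [_ /(_ isT)|[]]; last first.
  by exists b; split=> //; apply/coneP/(lepm_trans ba)/coneP.
rewrite -{1}(submK ba) mdegD -{2}[mdeg b]add0n leq_add2r leqn0 mdeg_eq0.
by move=> /eqP ab; rewrite -(submK ba) ab add0m.
Qed.

Let rseq a : seqlexi nat := [seq a j | j <- rev (enum 'I_n)].

Lemma rseq_inj : injective rseq.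
Proof.
move=> a b /eq_in_map ab; apply/mnmP => j.
by apply: ab; rewrite mem_rev mem_enum.
Qed.

Lemma revlex_total a b : ~~ revlex a b -> ~~ revlex b a -> a = b.
Proof.
rewrite /revlex -!leNgt => ba ab; apply: rseq_inj; apply/le_anti.
by rewrite ab ba.
Qed.

(** The last coordinate at which [a] and [b] differ decides. *)
Lemma revlex_last_diff a b : revlex a b -> exists k : 'I_n,
  (a k < b k)%N /\ forall j : 'I_n, (k < j)%N -> a j = b j.
Proof.
have mem_l j : j \in rev (enum 'I_n) by rewrite mem_rev mem_enum.
(* Induction on the list of coordinates; all that matters is that they come in
   decreasing order. *)
suff H l : sorted (fun i j : 'I_n => (j < i)%N) l ->
  ([seq a j | j <- l] < [seq b j | j <- l] :> seqlexi nat)%O ->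
  exists k : 'I_n, (a k < b k)%N /\
    forall j, j \in l -> (k < j)%N -> a j = b j.
  case/H=> [|k [ak bk]]; last by exists k; split=> // j; apply: bk.
  rewrite rev_sorted; have := iota_ltn_sorted 0 n.
  by rewrite -val_enum_ord sorted_map.
elim: l => [//|x l IHl] xl; rewrite /= ltxi_cons leEnat => /andP[].
rewrite leq_eqVlt => /orP[/eqP abx|abx _].
  rewrite abx leqnn /= => /(IHl (path_sorted xl))[k [abk eqk]].
  by exists k; split=> // j; rewrite inE => /orP[/eqP->|/eqk].
exists x; split=> // j; rewrite inE => /orP[/eqP->|jl xj].
  by rewrite ltnn.
have/allP/(_ j jl) : all (fun j : 'I_n => (j < x)%N) l.
  by apply: order_path_min xl => p q r /= pq qr; apply: ltn_trans pq.
by rewrite ltnNge ltnW.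
Qed.

(** If [a] vanishes from coordinate [i] on, the deciding coordinate is at most
    [i.-1], since [a] is positive there. *)
Lemma revlex_Nsub i a b (j : 'I_n) :
  Nsub i a -> revlex b a -> (i.-1 <= j)%N -> (b j <= a j)%N.
Proof.
move=> ai /revlex_last_diff[k [bak eqk]] ij.
have ki : (k < i)%N by rewrite ltnNge; apply: contraTN bak => /ai ->.
have /= := ltngtP k j; case=> [/eqk->//|jk|/val_inj<-]; last exact: ltnW.
by move: ki; case: i ij {ai} => //= i ij; rewrite ltnS leqNgt (leq_ltn_trans ij).
Qed.

Lemma level_uniq a i k : level a i -> level a k -> i = k.
Proof.
move=> [i0 ai mini] [k0 ak mink].
by apply/eqP; rewrite eqn_leq mini // mink.
Qed.

Lemma level_exists a : (0 < n)%N -> exists2 i, (0 < i <= n)%N & level a i.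
Proof.
move=> n0; pose P i := (0 < i)%N && `[< Nsub i a >].
have Pn : P n.
  by apply/andP; split=> //; apply/asboolP => j nj; have := ltn_ord j; rewrite ltnNge nj.
case: (ex_minnP (ex_intro P n Pn)) => i /andP[i0 /asboolP ai] mini.
exists i; first by rewrite i0 mini.
by split=> // k k0 ak; apply: mini; rewrite /P k0; apply/asboolP.
Qed.

(** * Cells and the sets B_i *)

(** The product structure of a cell: for a vertex [b] before [a], whether [b] lies
    below [a + g] does not depend on the coordinates of [g] from [i.-1] on, because
    there [b] is below [a] already. *)
Lemma cell_proj D i a g : Nsub i a ->
  cell D a (a + g)%MM <-> cell D a (a + proj i.-1 g)%MM.
Proof.
move=> ai; rewrite /cell; split=> -[_ ag]; (split; first by apply/coneP/lem_addr).
all: move=> [b [vb ba] /coneP/mnm_lepP bag]; apply: ag; exists b => //.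
all: apply/coneP/mnm_lepP => j; have := bag j; rewrite !mnmDE projE.
  by case: ltnP => // _ bj; apply: (leq_trans bj); rewrite leq_add2l.
case: ltnP => // ij _; rewrite addn0.
exact: revlex_Nsub ba ij.
Qed.

Lemma cell_sub D a : diagram D -> vertex D a -> cell D a `<=` D.
Proof. by move=> dD [Da _] m [am _]; apply: diagram_upward am. Qed.

Lemma cell_uniq D a b m : vertex D a -> vertex D b ->
  cell D a m -> cell D b m -> a = b.
Proof.
move=> va vb [am nam] [bm nbm]; apply: revlex_total; apply/negP => ab.
- by apply: nbm; exists a.
- by apply: nam; exists b.
Qed.

(** The cell of [m] is that of the [revlex]-smallest vertex below [m]. The minimum
    exists because only finitely many exponents have degree at most that of [m]. *)
Lemma cell_exists D m : D m -> exists2 a, vertex D a & cell D a m.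
Proof.
move=> /vertex_below[a0 va0 a0m].
have lt_deg a : (a <= m)%MM -> (mdeg a < (mdeg m).+1)%N.
  by move=> /submK <-; rewrite mdegD ltnS leq_addl.
pose P (a : 'X_{1..n < (mdeg m).+1}) := `[< vertex D a /\ cone a m >].
have a0P : P (BMultinom (lt_deg a0 (iffLR (coneP _ _) a0m))) by apply/asboolP.
case: (arg_minP (fun a : 'X_{1..n < (mdeg m).+1} => rseq a) a0P).
move=> a /asboolP[va am] mina; exists (bmnm a) => //; split=> //.
case=> b [vb ba] /coneP bm.
have Pb : P (BMultinom (lt_deg b bm)) by apply/asboolP; split=> //; apply/coneP.
by have := mina _ Pb; rewrite leNgt => /negP; apply.
Qed.

(** The translate of [tail i.-1] by an element [b] of [B_i] stays in the cell that
    [b] comes from; the formula for [b] shows that [m] determines it. *)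
Lemma Bset_cell D i b m : Bset D i b -> translate (tail i.-1) b m ->
  exists a, [/\ vertex D a, level a i, cell D a m
    & b = (a + proj i.-1 (m - a))%MM].
Proof.
move=> [a [va la] [_ [g Dg <-] <-]] [t ti <-]; exists a.
have projgt : proj i.-1 (proj i.-1 g + t)%MM = proj i.-1 g.
  by rewrite proj_addm (proj_tail ti) addm0 proj_proj minnn.
have [_ ai _] := la.
rewrite -addmA; split=> //.
  by apply: (iffRL (cell_proj D _ ai)); rewrite projgt; apply: (iffLR (cell_proj D _ ai)).
by rewrite [X in proj _ (X - _)%MM]addmC addmK projgt.
Qed.

(** The translating element of [B_i] is obtained by truncating the offset of [m] from
    its vertex. *)
Lemma cell_Bset D i a m : vertex D a -> level a i -> cell D a m ->
  exists2 b, Bset D i b & translate (tail i.-1) b m.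
Proof.
move=> va la am; have [g _ gm] := am.1; rewrite -gm in am *.
exists (a + proj i.-1 g)%MM.
  by exists a => //; exists (proj i.-1 g) => //; exists g.
have [t ti] := translate_proj i.-1 g.
by move=> {2}<-; exists t; rewrite ?addmA.
Qed.

Lemma trivIset_Bset D i : trivIset (Bset D i) (translate (tail i.-1)).
Proof.
move=> b c Bb Bc [m [/(Bset_cell Bb)[a [va _ am ->]] /(Bset_cell Bc)[a' [va' _ am' ->]]]].
by rewrite (cell_uniq va va' am am').
Qed.

(** * Truncations of D and the sets A_i *)

(** The i-th projection of [m] belongs to that of [D], stated without [proj] so that
    the dependence on [i] is visibly monotone. *)
Definition attained D i m : Prop :=
  exists2 d, D d & forall j : 'I_n, (j < i)%N -> d j = m j.

Lemma attained_proj D i m : (proj i @` D) (proj i m) <-> attained D i m.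
Proof.
split=> -[d Dd dm]; exists d => //.
  by move=> j ji; have /mnmP/(_ j) := dm; rewrite !projE ji.
by apply/mnmP => j; rewrite !projE; case: ltnP => // /dm.
Qed.

Lemma attained_leq D i k m : (i <= k)%N -> attained D k m -> attained D i m.
Proof. by move=> ik [d Dd dm]; exists d => // j ji; apply: dm; apply: leq_trans ik. Qed.

(** An exponent belongs to the [A_i]-part when [i] is the first number of coordinates
    that no element of [D] shares with it. *)
Lemma Aset_proj D i m :
  Aset D i (proj i m) <-> ~ attained D i m /\ attained D i.-1 m.
Proof.
rewrite -!attained_proj /Aset /Gbar /timesN /=.
rewrite proj_proj (minn_idPl (leq_pred i)); split.
  move=> [[_ nD] nG]; split=> //; apply: contrapT => nD'.
  by apply: nG; split; [apply: Nsub_proj|split=> //; apply: Nsub_proj].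
by move=> [nD Dp]; split; [split=> //; apply: Nsub_proj|case=> _ []].
Qed.

Lemma trivIset_Aset D i : trivIset (Aset D i) (translate (tail i)).
Proof.
move=> a b [[ai _] _] [[bi _] _] [m [am bm]].
by rewrite -(proj_translate ai am) (proj_translate bi bm).
Qed.

(** Since [A_i] is contained in N^i, translating it by [tail i] gives its whole
    preimage under the projection. *)
Lemma Aset_translate D i m :
  (\bigcup_(a in Aset D i) translate (tail i) a) m <->
  ~ attained D i m /\ attained D i.-1 m.
Proof.
rewrite -Aset_proj; split; last by exists (proj i m) => //; apply: translate_proj.
by move=> [a Da am]; have [[ai _] _] := Da; rewrite (proj_translate ai am).
Qed.

(** The blocks of [B_i] fill exactly the cells of the vertices of level [i]. *)
Lemma Bset_translate D i m :
  (\bigcup_(b in Bset D i) translate (tail i.-1) b) m <->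
  exists a, [/\ vertex D a, level a i & cell D a m].
Proof.
split=> [[b Bb /(Bset_cell Bb)[a [va la am _]]]|[a [va la]]]; first by exists a.
by move=> /(cell_Bset va la)[b Bb bm]; exists b.
Qed.

End Exponents.

(** * The partition of the exponents into blocks *)

Section Blocks.
Variable n : nat.
Implicit Types (D : set 'X_{1..n}) (a b m : 'X_{1..n}) (i k : nat).

Definition blockA D i : set 'X_{1..n} :=
  \bigcup_(a in Aset D i) translate (tail i) a.

Definition blockB D i : set 'X_{1..n} :=
  \bigcup_(b in Bset D i) translate (tail i.-1) b.

Lemma attained0 D m : D !=set0 -> attained D 0 m.
Proof. by case=> d Dd; exists d. Qed.

Lemma attained_all D m : attained D n m <-> D m.
Proof.
split=> [[d Dd dm]|Dm]; last by exists m.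
by rewrite (_ : m = d) //; apply/mnmP => j; rewrite dm.
Qed.

Lemma blockA_sub D i : (i <= n)%N -> blockA D i `<=` ~` D.
Proof.
move=> i_le m /Aset_translate[nDi _] Dm; apply: nDi.
exact: attained_leq i_le (iffRL (attained_all _ _) Dm).
Qed.

Lemma blockB_sub D i : diagram D -> blockB D i `<=` D.
Proof. by move=> dD m /Bset_translate[a [va _ am]]; apply: cell_sub am. Qed.

Lemma blockA_uniq D i k m : (0 < i)%N -> (0 < k)%N ->
  blockA D i.-1 m -> blockA D k.-1 m -> i = k.
Proof.
wlog ik : i k / (i <= k)%N.
  by move=> H i0 k0 im km; have [ik|/ltnW ki] := leqP i k; [|symmetry]; apply: H.
move=> i0 k0 /Aset_translate[nDi _] /Aset_translate[_ Dk].
apply/eqP; rewrite eqn_leq ik leqNgt; apply/negP => i_lt_k; apply: nDi.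
by apply: attained_leq Dk; case: i k i0 k0 i_lt_k {ik} => [|i] [|[|k]].
Qed.

Lemma blockB_uniq D i k m : blockB D i m -> blockB D k m -> i = k.
Proof.
move=> /Bset_translate[a [va la am]] /Bset_translate[b [vb lb bm]].
by apply: (level_uniq la); rewrite (cell_uniq va vb am bm).
Qed.

(** The block of [m] outside [D] is found as the least [i] at which the truncation
    of [m] is no longer one of an element of [D]; it is positive as [D] is not
    empty. *)
Lemma blockA_cover D : D !=set0 ->
  \bigcup_(i in [set i : nat | (0 < i <= n.+1)%N]) blockA D i.-1 = ~` D.
Proof.
move=> D0; apply/seteqP; split=> [m [i /andP[i0 i_le]]|m nDm].
  by apply: blockA_sub; rewrite -ltnS prednK.
pose P i := `[< ~ attained D i m >].
have Pn : P n by apply/asboolP; rewrite attained_all.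
case: (ex_minnP (ex_intro P n Pn)) => i /asboolP nDi mini.
have i0 : (0 < i)%N by case: i nDi {mini} => [[]|//]; apply: attained0.
exists i.+1 => /=; first by rewrite ltnS mini.
apply/Aset_translate; split=> //; apply: contrapT => nD.
have : (i <= i.-1)%N by apply: mini; apply/asboolP.
by rewrite leqNgt ltn_predL i0.
Qed.

Lemma blockB_cover D : (0 < n)%N -> diagram D ->
  \bigcup_(i in [set i : nat | (0 < i <= n.+1)%N]) blockB D i = D.
Proof.
move=> n0 dD; apply/seteqP; split=> [m [i _]|m Dm]; first exact: blockB_sub.
have [a va am] := cell_exists Dm; have [i /andP[i0 i_le] la] := level_exists a n0.
exists i; first by rewrite /= i0 leqW.
by apply/Bset_translate; exists a.
Qed.

Lemma blockA0 D : D !=set0 -> blockA D 0 = set0.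
Proof.
by move=> D0; rewrite -subset0 => m /Aset_translate[[]]; apply: attained0.
Qed.

Lemma blockB_big D i : (0 < n < i)%N -> blockB D i = set0.
Proof.
case/andP=> n0 ni; rewrite -subset0 => m /Bset_translate[a [_ la _]].
have [k /andP[_ kn] lk] := level_exists a n0.
by move: ni; rewrite ltnNge -(level_uniq lk la) kn.
Qed.

End Blocks.

(** * The modules of the blocks *)

Lemma eq_direct_sum (V : zmodType) (I : choiceType) (N : set V) (P : set I)
    (M M' : I -> set V) : (forall i, P i -> M i = M' i) ->
  is_direct_sum N P M' -> is_direct_sum N P M.
Proof.
move=> MM' [-> dM']; split; last first.
  move=> s v us sv; apply: dM' => // i /sv[Pi Mi]; split=> //.
  by rewrite -MM'.
by apply/seteqP; split=> _ [s [v [us sv ->]]]; exists s, v; split=> // i /sv[Pi];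
  rewrite MM'.
Qed.

Section ModulesOfBlocks.
Variables (K : comNzRingType) (n : nat).
Implicit Types (D : set 'X_{1..n}) (i : nat).

Lemma Rlast_tail i : (i <= n)%N -> Rlast K (n - i) = supported K (@tail n i).
Proof. by move=> i_le; rewrite /Rlast subKn. Qed.

Lemma MA_direct_sum D i : (i <= n)%N ->
  is_direct_sum (supported K (blockA D i)) (Aset D i)
    (fun a => cyclic_mod (Rlast K (n - i)) 'X_[a]).
Proof.
by move=> i_le; rewrite Rlast_tail //; apply: direct_sum_translates; apply: trivIset_Aset.
Qed.

(** At [i = 0] the module is 0 by convention, in agreement with [A_0] being empty:
    the projection to N^0 of a nonempty set is everything. *)
Lemma MA_supported D i : D !=set0 -> (i <= n)%N ->
  MA K D i = supported K (blockA D i).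
Proof.
move=> D0 i_le; rewrite /MA; case: ifP => [_|].
  by case: (MA_direct_sum D i_le) => ->.
by rewrite i_le andbT; case: i {i_le} => // _; rewrite blockA0 // supported0.
Qed.

(** At [i = n.+1] the module is 0 by convention, in agreement with the absence of
    vertices of level above [n]. *)
Lemma MB_supported D i : (0 < n)%N -> (0 < i <= n.+1)%N ->
  MB K D i = supported K (blockB D i).
Proof.
move=> n0 /andP[i0 i_le]; rewrite /MB i0 /=; case: leqP => [_|ni].
  rewrite -(prednK i0) subSS Rlast_tail ?(prednK i0); last by rewrite -ltnS prednK.
  by case: (direct_sum_translates K (@trivIset_Bset _ D i)) => ->.
by rewrite blockB_big ?supported0 // n0.
Qed.

End ModulesOfBlocks.

(** * The decomposition *)

Theorem corollary3p4p5 (K : comNzRingType) (n : nat) (n_gt0 : (0 < n)%N)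
    (D : set 'X_{1..n}) (diagD : diagram D) (D_neq0 : D !=set0)
    (ftD : finite_type D) :
  [/\ (* M^A_i is the direct sum of the R_{n-i} x^a, a in A_i *)
      forall i : nat, (0 < i <= n)%N ->
        is_direct_sum (MA K D i) (Aset D i)
          (fun a => cyclic_mod (Rlast K (n - i)) 'X_[a]),
      (* the sums M^A_{i-1} + M^B_i are direct and free over R_{n-i+1} *)
      forall i : nat, (0 < i <= n.+1)%N ->
        is_direct_sum2 (msum2 (MA K D i.-1) (MB K D i)) (MA K D i.-1) (MB K D i)
        /\ free_mod (Rlast K (n.+1 - i)) (msum2 (MA K D i.-1) (MB K D i)),
      (* R_n is their direct sum, and the direct sum of R_n^D and R_n^(~D) *)
      is_direct_sum [set: {mpoly K[n]}] [set i : nat | (0 < i <= n.+1)%N]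
          (fun i => msum2 (MA K D i.-1) (MB K D i))
        /\ is_direct_sum2 [set: {mpoly K[n]}]
             (supported K D) (supported K (~` D)),
      is_direct_sum (supported K D) [set i : nat | (0 < i <= n.+1)%N]
        (MB K D)
    & is_direct_sum (supported K (~` D)) [set i : nat | (0 < i <= n.+1)%N]
        (fun i => MA K D i.-1)].
Proof.
have pred_le i : (0 < i <= n.+1)%N -> (i.-1 <= n)%N.
  by case/andP=> i0 i_le; rewrite -ltnS prednK.
have MAE i : (0 < i <= n.+1)%N -> MA K D i.-1 = supported K (blockA D i.-1).
  by move=> /pred_le; apply: MA_supported.
have MBE i : (0 < i <= n.+1)%N -> MB K D i = supported K (blockB D i).
  exact: MB_supported.
have AB0 i : (0 < i <= n.+1)%N -> blockA D i.-1 `&` blockB D i = set0.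
  move=> /pred_le i_le; rewrite -subset0 => m [/(blockA_sub i_le) nDm].
  by move/(blockB_sub diagD).
have sumE i : (0 < i <= n.+1)%N ->
    msum2 (MA K D i.-1) (MB K D i) = supported K (blockA D i.-1 `|` blockB D i).
  move=> i_in; rewrite MAE // MBE //.
  by have [-> _] := direct_sum2_supported K (AB0 i i_in).
have fullE : [set: {mpoly K[n]}] = supported K [set: 'X_{1..n}].
  by apply/seteqP; split=> // f _ m.
split.
- move=> i /andP[_ i_le]; rewrite MA_supported //; exact: MA_direct_sum.
- move=> i i_in; split.
    by rewrite sumE // MAE // MBE //; apply: direct_sum2_supported; apply: AB0.
  have [i0 _] := andP i_in.
  rewrite sumE // -(prednK i0) subSS Rlast_tail ?pred_le // prednK //.
  rewrite /blockA /blockB -bigcup_setU; apply: free_translates.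
  (* Translates from A_{i-1} avoid D and those from B_i lie in D, so only
     translates of the same kind could meet. *)
  move=> a b [Aa|Ba] [Ab|Bb] ab.
  + exact: (trivIset_Aset Aa Ab ab).
  + case: ab => m [am bm]; have : (blockA D i.-1 `&` blockB D i) m.
      by split; [exists a|exists b].
    by rewrite AB0 // => -[].
  + case: ab => m [am bm]; have : (blockA D i.-1 `&` blockB D i) m.
      by split; [exists b|exists a].
    by rewrite AB0 // => -[].
  + exact: (trivIset_Bset Ba Bb ab).
- split; last first.
    by rewrite fullE -(setUv D); apply: direct_sum2_supported; rewrite setICr.
  apply: (eq_direct_sum sumE).
  rewrite fullE -(setUv D) setUC -(blockA_cover D_neq0) -{2}(blockB_cover n_gt0 diagD).
  rewrite -bigcupU; apply: direct_sum_supported.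
  move=> i k i_in k_in [m [[Ai|Bi] [Ak|Bk]]].
  + by case/andP: i_in => i0 _; case/andP: k_in => k0 _; apply: blockA_uniq Ai Ak.
  + by have := blockA_sub (pred_le i i_in) Ai; case; apply: blockB_sub Bk.
  + by have := blockA_sub (pred_le k k_in) Ak; case; apply: blockB_sub Bi.
  + exact: blockB_uniq Bi Bk.
- apply: (eq_direct_sum MBE); rewrite -{1}(blockB_cover n_gt0 diagD).
  apply: direct_sum_supported => i k _ _ [m [Bi Bk]]; exact: blockB_uniq Bi Bk.
- apply: (eq_direct_sum MAE); rewrite -(blockA_cover D_neq0).
  apply: direct_sum_supported => i k /andP[i0 _] /andP[k0 _] [m [Ai Ak]].
  exact: blockA_uniq Ai Ak.
Qed.
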